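(* Let $G$ be an abelian Lie group whose identity component $G^0$ has finite index in $G$. Let $S$ be a finitely generated subsemigroup of $G$ which is somewhere dense in $G$, i.e. its closure $\overline{S}$ contains a non-empty open subset of $G$. Then $\overline{S}$ is a subgroup of $G$ and contains $G^0$. *)

(* Defs.v *)
From HB Require Import structures.
From mathcomp Require Import all_boot all_order all_algebra.
From mathcomp Require Import all_classical all_reals all_analysis.
Set Implicit Arguments. Unset Strict Implicit. Unset Printing Implicit Defensive.
Import Order.TTheory GRing.Theory Num.Theory.
Import numFieldTopology.Exports.
Local Open Scope classical_set_scope.
Local Open Scope ring_scope.

(* A (real) Lie group, topologically: a Hausdorff topological group that is
   locally Euclidean, i.e. every point has an open neighbourhood homeomorphic
   to an open subset of R^n (R^n = 'rV[R]_n with its product topology).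
   By Gleason--Montgomery--Zippin (Hilbert's 5th problem) these are exactly
   the topological groups underlying Lie groups. *)
Definition locally_euclidean (R : realType) (G : topologicalType) : Prop :=
  forall x : G, exists (U : set G) (n : nat) (V : set 'rV[R]_n)
    (f : G -> 'rV[R]_n) (g : 'rV[R]_n -> G),
    [/\ open U, U x, open V & f @` U = V] /\
    [/\ {within U, continuous f}, {within V, continuous g},
        (forall u, U u -> g (f u) = u) & (forall v, V v -> f (g v) = v)].

Definition abelian_lie_group (R : realType) (G : topologicalZmodType) : Prop :=
  hausdorff_space G /\ locally_euclidean R G.

Definition identity_component (G : topologicalZmodType) : set G :=
  connected_component setT 0.

Definition finite_index (G : zmodType) (H : set G) : Prop :=
  exists s : seq G, forall g : G, exists2 x, x \in s & H (g - x).

Definition subsemigroup_gen (G : zmodType) (A : set G) : set G :=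
  [set x | forall T : set G, A `<=` T ->
     (forall a b, T a -> T b -> T (a + b)) -> T x].

Definition finitely_generated_subsemigroup (G : zmodType) (S : set G) : Prop :=
  exists A : set G, finite_set A /\ S = subsemigroup_gen A.

Definition somewhere_dense (G : topologicalType) (S : set G) : Prop :=
  exists U : set G, [/\ open U, U !=set0 & U `<=` closure S].

Definition is_subgroup (G : zmodType) (H : set G) : Prop :=
  H 0 /\ (forall x y, H x -> H y -> H (x - y)).
Arguments identity_component : clear implicits.

(* Main.v *)
Require Import Defs.
From HB Require Import structures.
From mathcomp Require Import all_boot all_order all_algebra.
From mathcomp Require Import all_classical all_reals all_analysis.
Set Implicit Arguments.
Unset Strict Implicit.
Import GRing.Theory.
Local Open Scope classical_set_scope.
Local Open Scope ring_scope.

(** Let [a_0, ..., a_(m-1)] generate [S], let [M] be the closure of the monoid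
    of their natural combinations, and let [K = M `&` - M] (below
    [units_of_closure]), a closed subgroup. Along an ultrafilter of coefficient
    vectors each coefficient is either eventually constant or tends to infinity.
    If the combinations converge, differences of two of them tend to [0]; taking
    the second one much further along the ultrafilter, such a difference
    dominates any generator [a_j] whose coefficient is unbounded, so [- a_j]
    lies in [M] and [a_j] in [K]. Hence the combinations are eventually in the
    [K]-coset of their limit, and near an interior point [M] is a single coset
    of [K]. So [K] is open and contains the identity component. By finite index
    every element has a positive multiple in [K], which makes [M] a group; as
    [S] is nonempty, [0] is in the closure of [S], and that closure is [M]. *)

(** * Closures and subgroups in abelian groups *)

Lemma closure_add (G : topologicalZmodType) (A B C : set G) x y :
  (forall a b, A a -> B b -> C (a + b)) ->
  closure A x -> closure B y -> closure C (x + y).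
Proof.
move=> ABC clA clB V /(@add_continuous G (x, y)) [[P Q] /= [xP yQ] PQV].
have [a [Aa Pa]] := clA _ xP; have [b [Bb Qb]] := clB _ yQ.
by exists (a + b); split; [exact: ABC|exact: (PQV (a, b))].
Qed.

Lemma subr_cst_continuous (G : topologicalZmodType) (c : G) :
  continuous (fun y : G => y - c).
Proof.
move=> y; apply: (@continuous2_cvg _ _ _ _ _ _ _ _ (fun u v : G => u - v)).
- exact: (@sub_continuous G (y, c)).
- exact: cvg_id.
- exact: cvg_cst.
Qed.

Lemma subgroup_opp (G : zmodType) (K : set G) x :
  is_subgroup K -> K x -> K (- x).
Proof. by move=> [K0 KB] Kx; rewrite -sub0r; exact: KB. Qed.

Lemma subgroup_add (G : zmodType) (K : set G) x y :
  is_subgroup K -> K x -> K y -> K (x + y).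
Proof.
move=> gK Kx Ky; rewrite -[y]opprK.
by apply: gK.2 => //; exact: subgroup_opp.
Qed.

Lemma subgroup_natmul (G : zmodType) (K : set G) x k :
  is_subgroup K -> K x -> K (x *+ k).
Proof.
move=> gK Kx; elim: k => [|k IH]; first by rewrite mulr0n; exact: gK.1.
by rewrite mulrS; exact: subgroup_add.
Qed.

(** Pigeonhole: of the [size s + 1] multiples [g *+ 0], ..., [g *+ size s], two share a
    representative in [s], and their difference is a positive multiple of [g] in [K]. *)
Lemma finite_index_natmul (G : zmodType) (K : set G) (g : G) :
  is_subgroup K -> finite_index K -> exists k : nat, K (g *+ k.+1).
Proof.
move=> gK [s sP].
have /choice [r rP] (k : nat) : exists x, x \in s /\ K (g *+ k - x).
  by have [x xs Kx] := sP (g *+ k); exists x.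
have rlt (k : 'I_(size s).+1) : (index (r k) s < size s)%N.
  by rewrite index_mem; exact: (rP k).1.
pose f k := Ordinal (rlt k).
have /injectivePn [i [j ij fij]] : ~~ injectiveb f.
  apply/negP => /injectiveP /leq_card.
  by rewrite !card_ord ltnn.
have rij : r i = r j.
  move/(congr1 (fun u => nth 0 s (val u))) : fij => /=.
  by rewrite !nth_index //; [exact: (rP j).1|exact: (rP i).1].
have key (p q : nat) : (p < q)%N -> r p = r q -> exists k : nat, K (g *+ k.+1).
  move=> pq rpq; exists (q - p).-1; rewrite prednK ?subn_gt0//.
  rewrite mulrnBr ?(ltnW pq)//.
  rewrite (_ : g *+ q - g *+ p = (g *+ q - r q) - (g *+ p - r p)).
    by apply: gK.2; [exact: (rP q).2|exact: (rP p).2].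
  by rewrite rpq opprB addrA subrK.
have : (i != j :> nat) by [].
rewrite neq_ltn => /orP[] lt; first exact: key lt rij.
exact: key lt (esym rij).
Qed.

(** The trace of [K] on the connected identity component is clopen and contains [0], so it is
    everything. *)
Lemma open_subgroup_component (G : topologicalZmodType) (K : set G) :
  is_subgroup K -> open K -> closed K -> identity_component G `<=` K.
Proof.
move=> [K0 _] oK cK; rewrite /identity_component.
rewrite -(@component_connected G setT 0 (identity_component G `&` K)).
- exact: subIsetr.
- by exists 0; split => //; exact: connected_component_refl.
- by exists K.
- by exists K.
Qed.

(** An ultrafilter contains each level set of [u] or its complement; if it contains no level set,
    the values are excluded one by one. *)
Lemma ultra_nat_dichotomy (T : Type) (F : set_system T) (u : T -> nat) :
  UltraFilter F ->
  (exists c, \forall n \near F, u n = c) \/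
  (forall k, \forall n \near F, (k <= u n)%N).
Proof.
move=> FU; have FP := ultra_proper.
have [|nc] := pselect (exists c, \forall n \near F, u n = c); first by left.
right; elim=> [|k IH]; first exact: nearW.
have [Fk|Fk] := in_ultra_setVsetC [set n | u n = k] FU.
  by case: nc; exists k.
apply: filterS2 IH Fk => n /= kn /eqP nk.
by rewrite ltn_neqAle eq_sym nk kn.
Qed.

(** * The closed monoid of natural combinations and its units *)

Section Combinations.
Variables (G : topologicalZmodType) (m : nat) (a : 'I_m -> G).

Definition natcomb (n : 'I_m -> nat) : G := \sum_i a i *+ n i.

Definition units_of_closure : set G :=
  [set y | closure (range natcomb) y /\ closure (range natcomb) (- y)].

Lemma natcombD n p :
  natcomb (fun i => n i + p i)%N = natcomb n + natcomb p.
Proof. by rewrite -big_split/=; apply: eq_bigr => i _; rewrite mulrnDr. Qed.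

Lemma natcomb_gen j : natcomb (fun i => i == j) = a j.
Proof.
rewrite /natcomb (bigD1 j)//= eqxx big1 ?addr0// => i /negbTE ->.
by rewrite mulr0n.
Qed.

Lemma range_natcomb0 : range natcomb 0.
Proof. by exists (fun=> 0%N) => //; rewrite /natcomb big1. Qed.

Lemma range_natcombD x y :
  range natcomb x -> range natcomb y -> range natcomb (x + y).
Proof.
by move=> [n _ <-] [p _ <-]; exists (fun i => n i + p i)%N => //; exact: natcombD.
Qed.

Lemma closure_natcombD x y : closure (range natcomb) x ->
  closure (range natcomb) y -> closure (range natcomb) (x + y).
Proof. by apply: closure_add => u v; exact: range_natcombD. Qed.

Lemma units_of_closure_subgroup : is_subgroup units_of_closure.
Proof.
split.
  by split; rewrite ?oppr0; apply: subset_closure; exact: range_natcomb0.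
move=> x y [Mx MNx] [My MNy].
by split; rewrite ?opprD ?opprK; exact: closure_natcombD.
Qed.

Lemma units_of_closure_closed : closed units_of_closure.
Proof.
apply: closedI; first exact: closed_closure.
apply: preimage_closed; last exact: closed_closure.
by move=> x _; exact: opp_continuous.
Qed.

Lemma natcomb_unbounded (F : set_system ('I_m -> nat)) (x : G) (j : 'I_m) :
  UltraFilter F -> natcomb n @[n --> F] --> x ->
  (forall k, \forall n \near F, (k <= n j)%N) -> units_of_closure (a j).
Proof.
move=> FU Fx jinf; have FP := ultra_proper; split.
  by apply: subset_closure; exists (fun i => i == j) => //; exact: natcomb_gen.
(* Here [p] is fixed before [q]: constant coefficients agree, unbounded ones eventually exceed any
   bound set by [p], and coordinate [j] leaves room for one extra [a j]. *)
have dom : \forall p \near F, \forall q \near F,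
    forall i, (p i + (i == j) <= q i)%N.
  suff : \forall p \near F, forall i, \forall q \near F,
      (p i + (i == j) <= q i)%N.
    by apply: filterS => p; exact: filter_forall.
  apply: filter_forall => i.
  have [->|ij] := eqVneq i j; first by apply: nearW => p; exact: jinf.
  have [[c Fc]|iinf] := ultra_nat_dichotomy (@^~ i) FU.
    apply: filterS (Fc) => p ->.
    by apply: filterS (Fc) => q ->; rewrite addn0.
  by apply: nearW => p; exact: iinf.
have cts : (z.1 - z.2 - a j) @[z --> (x, x)] --> - a j.
  rewrite -[X in _ --> X](_ : x - x - a j = _); last by rewrite subrr sub0r.
  apply: (cvg_comp (fun z : G * G => z.1 - z.2) (fun y => y - a j)).
    exact: (@sub_continuous G (x, x)).
  exact: subr_cst_continuous.
move=> V /cts [[P Q] /= [xP xQ] PQV].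
have [p [domp Qp]] := filter_ex (filterI dom (Fx _ xQ)).
have [q [domq Pq]] := filter_ex (filterI domp (Fx _ xP)).
exists (natcomb q - natcomb p - a j); split.
  (* The truncated subtraction is exact by [domq]. *)
  exists (fun i => q i - (p i + (i == j)))%N => //.
  rewrite -(natcomb_gen j) -addrA -opprD -natcombD -sumrB.
  by apply: eq_bigr => i _; rewrite mulrnBr.
exact: (PQV (natcomb q, natcomb p)).
Qed.

(** Differences of combinations lie in the units term by term: constant coefficients cancel, and
    unbounded ones multiply units. Closedness then allows passing to the limit in one of the two. *)
Lemma ultra_limit_coset (F : set_system ('I_m -> nat)) (x : G) :
  UltraFilter F -> natcomb n @[n --> F] --> x ->
  \forall n \near F, units_of_closure (natcomb n - x).
Proof.
move=> FU Fx; have FP := ultra_proper.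
have gK := units_of_closure_subgroup.
have FK : \forall n \near F, \forall p \near F,
    units_of_closure (natcomb p - natcomb n).
  have : \forall n \near F, forall i, \forall p \near F,
      units_of_closure (a i *+ p i - a i *+ n i).
    apply: filter_forall => i.
    have [[c Fc]|iinf] := ultra_nat_dichotomy (@^~ i) FU.
      apply: filterS (Fc) => n nc; apply: filterS (Fc) => p pc.
      by rewrite nc pc subrr; exact: gK.1.
    have Ki := natcomb_unbounded FU Fx iinf.
    by apply: nearW => n; apply: nearW => p; apply: gK.2; exact: subgroup_natmul.
  apply: filterS => n /filter_forall; apply: filterS => p Kp.
  rewrite -sumrB; apply: (big_ind units_of_closure) => [||i _]; first exact: gK.1.
    by move=> u v; exact: subgroup_add.
  exact: Kp.
apply: filterS FK => n Kn; rewrite -opprB; apply: subgroup_opp => //.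
apply: (@closed_cvg _ _ F _ (fun p => natcomb p - natcomb n)).
- exact: units_of_closure_closed.
- exact: Kn.
- by apply: (cvg_comp natcomb (fun y => y - natcomb n) Fx);
    exact: subr_cst_continuous.
Qed.

(** Otherwise combinations outside the coset of [x] accumulate at [x], and an ultrafilter of them
    converging to [x] contradicts [ultra_limit_coset]. *)
Lemma units_of_closure_interior (x : G) : nbhs x (closure (range natcomb)) ->
  nbhs x [set y | units_of_closure (y - x)].
Proof.
move=> xM; apply: contrapT => nK.
pose B (V : set G) := [set n | V (natcomb n) /\ ~ units_of_closure (natcomb n - x)].
have oC : open [set y | ~ units_of_closure (y - x)].
  rewrite -closedC setCK.
  apply: (preimage_closed _ units_of_closure_closed) => y _.
  exact: subr_cst_continuous.
have FB : ProperFilter (filter_from (nbhs x) B).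
  apply: filter_from_proper.
    apply: filter_from_filter; first by exists setT; exact: filterT.
    move=> V W xV xW; exists (V `&` W); first exact: filterI.
    by move=> n [[Vn Wn] nKn]; split.
  move=> V xV.
  (* The point [y] is only a limit of combinations; taking it in an interior, and using that the
     complement of the coset is open, gives an actual combination nearby. *)
  have [y [VMy nKy]] : exists y, (V `&` closure (range natcomb))° y /\
      ~ units_of_closure (y - x).
    apply: contrapT => nex; apply: nK.
    have : nbhs x (V `&` closure (range natcomb))°.
      by apply: nbhs_interior; exact: filterI.
    apply: filterS => y VMy; apply: contrapT => nKy.
    by apply: nex; exists y.
  have [_ My] := interior_subset VMy.
  have [_ [[n _ <-] [[Vn _] nKn]]] := My _ (filterI VMy (open_nbhs_nbhs (conj oC nKy))).
  by exists n.
have [F [FU BF]] := ultraFilterLemma FB; have FP := ultra_proper.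
have Fx : natcomb n @[n --> F] --> x.
  by move=> V xV; apply: BF; exists V => // n [].
have nKF : \forall n \near F, ~ units_of_closure (natcomb n - x).
  by apply: BF; exists setT; [exact: filterT|move=> n []].
by have [n []] := filter_ex (filterI (ultra_limit_coset FU Fx) nKF).
Qed.

(** Translation by [z - x] carries the coset of [x] onto the subgroup, for any unit [z]. *)
Lemma units_of_closure_open (x : G) : nbhs x (closure (range natcomb)) ->
  open units_of_closure.
Proof.
move=> /units_of_closure_interior xK; rewrite openE => z Kz.
have : (y - (z - x)) @[y --> z] --> x.
  rewrite -[X in _ --> X](_ : z - (z - x) = _); last by rewrite subKr.
  exact: subr_cst_continuous.
move=> /(_ _ xK) xK'.
have : nbhs z [set y | units_of_closure (y - (z - x) - x)] by exact: xK'.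
apply: filterS => y /=.
rewrite opprB addrA addrAC addrK => Kyz.
by rewrite -(subrK z y); apply: subgroup_add => //; exact: units_of_closure_subgroup.
Qed.

End Combinations.

Lemma subsemigroup_genD (G : zmodType) (A : set G) x y :
  subsemigroup_gen A x -> subsemigroup_gen A y -> subsemigroup_gen A (x + y).
Proof. by move=> Ax Ay T AT TD; apply: (TD); [exact: Ax|exact: Ay]. Qed.

Lemma subsemigroup_gen_natcomb (G : topologicalZmodType) (s : seq G) :
  subsemigroup_gen [set` s] `|` [set 0] =
  range (natcomb (fun i : 'I_(size s) => s`_i)).
Proof.
rewrite eqEsubset; split=> x.
  case=> [|->]; last exact: range_natcomb0.
  apply; last by move=> u v; exact: range_natcombD.
  move=> y /= ys; have ylt : (index y s < size s)%N by rewrite index_mem.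
  exists (fun i => i == Ordinal ylt) => //.
  by rewrite natcomb_gen /= nth_index.
move=> [n _ <-].
pose T := subsemigroup_gen [set` s] `|` [set 0].
have TD u v : T u -> T v -> T (u + v).
  move=> [Su|->]; last by rewrite add0r.
  by move=> [Sv|->]; left; rewrite ?addr0//; exact: subsemigroup_genD.
apply: (big_ind T) => [|//|i _]; first by right.
elim: (n i) => [|k IH]; first by right.
rewrite mulrS; apply: TD => //; left => U sU _.
by apply: sU; rewrite /= mem_nth.
Qed.

Theorem theorem2p1 (R : realType) (G : topologicalZmodType) (S : set G) :
  abelian_lie_group R G ->
  finite_index (identity_component G) ->
  finitely_generated_subsemigroup S ->
  somewhere_dense S ->
  is_subgroup (closure S) /\ identity_component G `<=` closure S.
Proof.
move=> _ [t tP] [A [/finite_seqP [s ->] SE]] [U [oU [x Ux] US]].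
pose a (i : 'I_(size s)) := s`_i.
pose M := closure (range (natcomb a)).
have ME : M = closure (S `|` [set 0]).
  by rewrite SE subsemigroup_gen_natcomb.
pose K := units_of_closure a.
have gK : is_subgroup K by exact: units_of_closure_subgroup.
have SM : closure S `<=` M by rewrite ME; apply: closureS; exact: subsetUl.
have xM : nbhs x M.
  by apply: (@filterS _ _ _ U); [move=> y /US /SM|exact: open_nbhs_nbhs].
have GK : identity_component G `<=` K.
  apply: open_subgroup_component => //; first exact: units_of_closure_open xM.
  exact: units_of_closure_closed.
have MK y : M y -> K y.
  move=> My; split => //.
  have [|k [_ Kk]] := @finite_index_natmul G K y gK.
    by exists t => g; have [z zt /GK Kz] := tP g; exists z.
  (* Since [y *+ k.+1] is a unit, its opposite lies in [M]; adding [k] copies of [y] stays in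
     [M]. *)
  rewrite (_ : - y = y *+ k + - (y *+ k.+1)); last first.
    by rewrite mulrS opprD addrC addrNK.
  apply: closure_natcombD => //.
  elim: k {Kk} => [|k IH]; last by rewrite mulrS; exact: closure_natcombD.
  by apply: subset_closure; exact: range_natcomb0.
(* Adding an element of [S] sends [S] with [0] adjoined into [S], hence [M] into the closure of
   [S]. *)
have SMS y z : S y -> M z -> closure S (y + z).
  move=> Sy; rewrite ME; apply: (closure_add (A := S)); last exact: subset_closure.
  move=> u v Su [Sv|->]; last by rewrite addr0.
  by rewrite SE in Su Sv *; exact: subsemigroup_genD.
have [y [Sy _]] := US _ Ux _ filterT.
have SE' : closure S = K.
  rewrite eqEsubset; split=> z; first by move/SM/MK.
  (* Write [z] as [y + (z - y)] with [y] in [S] and [z - y] in [K], hence in [M]. *)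
  move=> Kz; rewrite -(subrK y z) addrC; apply: SMS => //.
  by have [] : K (z - y) by apply: gK.2 => //; exact/MK/SM/subset_closure.
by rewrite SE'.
Qed.
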